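(* Suppose that the following hold. (K-a) For every compact subset $Z_0\subset Z$ with projection $X_0$ on $X$, for every $\epsilon>0$ there is $\eta>0$ such that $\|k(\cdot,x')-k(\cdot,x)\|_k<\epsilon$ for all $x,x'\in X_0$ with $\|x'-x\|<\eta$. (K-b) There is a constant $\beta>0$ such that $\|f\|_k\le\beta$ for all $f\in\mathcal F$. (C-a) There is a gauge function $\phi:Z\to[0,\infty)$ such that $c(z,f(x))\le\phi(z)$ for all $z=(x,y)\in Z$ and $f\in\mathcal F$, and $\phi(z)\to\infty$ as $\|z\|\to\infty$. (C-b) $c:Z\times Y\to\mathbb R$ is continuous. (H) There exist a measurable function $r:Z\to\mathbb R_+$ and a constant $\nu\in(0,1]$ such that $|c(z,f(x))-c(z,g(x))|\le r(z)\,\|f-g\|_\infty^\nu$ for all $f,g\in\mathcal F$ and $z=(x,y)\in Z$. Let $\mathcal M_\kappa^{\phi^p}:=\{P\in\mathscr P(Z):\int_Z\phi(z)^p\,P(dz)<\kappa\}$ for some fixed $p>1$ and $\kappa>0$, and let $\mathcal M$ be a subset of $\mathcal M_\kappa^{\phi^p}$ that is compact in the $\phi$-weak topology. Then for every $\epsilon>0$ and $\delta>0$ there exists $N_0$ such that $$\sup_{P\in\mathcal M}P^{\otimes N}\left(|\vartheta(P_N,\lambda_N)-\vartheta(P)|\ge\delta\right)\le\epsilon$$ whenever $\lambda_N\le\frac{\delta}{4\beta^2}$ and $N\ge N_0$.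
   Context: Setting. $X$ is the input space and $Y\subseteq\mathbb R$ the output space; $X$ and $Z:=X\times Y$ are subsets of normed spaces, with norms denoted $\|\cdot\|$, and $Z$ is Polish; elements of $Z$ are written $z=(x,y)$. $\mathscr P(Z)$ is the set of Borel probability measures on $Z$. $k:X\times X\to\mathbb R$ is a given positive definite symmetric kernel (all matrices $[k(x_i,x_j)]_{ij}$ are symmetric positive semidefinite), $\mathcal H_k$ is its reproducing kernel Hilbert space (so $k(\cdot,x)\in\mathcal H_k$ and $f(x)=\langle f,k(\cdot,x)\rangle$ for $f\in\mathcal H_k$, $x\in X$), with norm $\|\cdot\|_k$. $\mathcal F$ is a (nonempty) subset of $\mathcal H_k$ of functions $X\to Y$. The cost function $c:Z\times Y\to\mathbb R$ is such that $c(z,f(x))\ge 0$. $\|\cdot\|_\infty$ is the sup norm on functions on $X$. A gauge function is a continuous $\phi:Z\to[0,\infty)$ with $\phi\ge 1$ outside a compact set. $\mathcal M_Z^\phi:=\{P\in\mathscr P(Z):\int_Z\phi\,dP<\infty\}$. The $\phi$-weak topology on $\mathcal M_Z^\phi$ is the topology generated by the metric $$\mathsf d_\phi(P',P''):=\mathsf d_{\mathrm{Prok}}(P',P'')+\left|\int_Z\phi\,dP'-\int_Z\phi\,dP''\right|,$$ where $\mathsf d_{\mathrm{Prok}}(P',P''):=\inf\{\epsilon>0:P'(A)\le P''(A^\epsilon)+\epsilon\text{ for all Borel }A\subset Z\}$ is the Prokhorov metric and $A^\epsilon$ is the set of points of $Z$ at distance less than $\epsilon$ from some point of $A$ (equivalently,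 it is the coarsest topology making $P\mapsto\int_Z h\,dP$ continuous for all continuous $h:Z\to\mathbb R$ with $|h|\le C(\phi+1)$ for some constant $C$). $\vartheta(P):=\inf_{f\in\mathcal F}\mathbb E_P[c(z,f(x))]$, where $\mathbb E_P[c(z,f(x))]=\int_Z c(z,f(x))\,P(dz)$. Samples $z^1,\dots,z^N$ (with $z^i=(x^i,y^i)$) are i.i.d. from $P$, $P_N:=\frac1N\sum_{i=1}^N\mathbb 1_{z^i}$ is the empirical measure ($\mathbb 1_{z^i}$ the Dirac measure at $z^i$), and $P^{\otimes N}$ is the product measure on $Z^{\otimes N}$ (the $N$-fold Cartesian product) with marginals $P$. For a regularization parameter $\lambda_N>0$, $$\vartheta(P_N,\lambda_N):=\inf_{f\in\mathcal F}\Big\{\frac1N\sum_{i=1}^N c(z^i,f(x^i))+\lambda_N\|f\|_k^2\Big\}.$$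
   Formalization: ''Z is Polish'' is taken to mean that Z is separable and complete for its norm metric (so Y is closed); if Z is only completely metrizable the claim can fail, e.g. for Y=(0,1) with a cost that has no continuous extension to the boundary of Y. *)

(* Defs.v *)
From HB Require Import structures.
From mathcomp Require Import all_boot all_order all_algebra.
From mathcomp Require Import ring lra.
From mathcomp Require Import all_classical all_reals all_analysis.

Set Implicit Arguments.
Unset Strict Implicit.
Unset Printing Implicit Defensive.

Import Order.TTheory GRing.Theory Num.Theory.
Import numFieldNormedType.Exports.

Local Open Scope classical_set_scope.
Local Open Scope ring_scope.

(* [set_type A] with the induced metric. The nonemptiness proof is a parameter
   of the type only because measurable types have to be pointed. *)
Definition subspace_of (T : Type) (A : set T) (A0 : A !=set0) : Type :=
  set_type A.

Section subspace_of_instances.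
Context (R : realType) (T : pseudoMetricType R) (A : set T) (A0 : A !=set0).

HB.instance Definition _ := PseudoMetric.copy (subspace_of A0) (set_type A).
HB.instance Definition _ := isPointed.Build (subspace_of A0)
  (exist _ (projT1 (cid A0)) (mem_set (projT2 (cid A0)))).

End subspace_of_instances.

Section data_space.
Context (R : realType) (E : normedModType R) (X : set E) (Y : set R).
Context (X0 : X !=set0) (Y0 : Y !=set0).

Definition data_space : Type := (subspace_of X0 * subspace_of Y0)%type.

HB.instance Definition _ := PseudoMetric.copy data_space
  (subspace_of X0 * subspace_of Y0)%type.
HB.instance Definition _ := Pointed.copy data_space
  (subspace_of X0 * subspace_of Y0)%type.

(* The norm of E * R is the maximum norm, which induces the metric above. *)
Definition data_norm (z : data_space) : R :=
  `|(set_val z.1, set_val z.2) : (E * R^o)%type|.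

End data_space.

Notation borel Z := (g_sigma_algebraType (@open Z)).

(* Completeness is required of the given metric, not merely of some metric
   inducing the same topology. *)
Definition polish (R : realType) (Z : pseudoMetricType R) : Prop :=
  (exists2 D : set Z, countable D & dense D) /\
  (forall F : set_system Z, ProperFilter F -> cauchy F ->
     exists z : Z, F --> z).

Section prokhorov.
Context (R : realType) (E : normedModType R) (X : set E) (Y : set R).
Context (X0 : X !=set0) (Y0 : Y !=set0).
Local Notation Z := (data_space X0 Y0).
Implicit Types (P Q S : probability (borel Z) R) (A : set Z) (e : R).

Definition enlargement A e : set Z := \bigcup_(a in A) ball a e.

Definition prokhorov_adm P Q : set R := [set e | 0 < e /\
  forall A : set (borel Z), measurable A ->
    (P A <= Q (enlargement A e) + e%:E)%E].

Definition prokhorov P Q : R := inf (prokhorov_adm P Q).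

Lemma ball_dataE (z : Z) e : ball z e = [set w : Z |
  ball (set_val z.1) e (set_val w.1) /\
  ball (set_val z.2 : R^o) e (set_val w.2)].
Proof. by []. Qed.

Lemma open_ball_data (z : Z) e : open (ball z e).
Proof.
rewrite openE => w; rewrite ball_dataE => -[/= b1 b2]; rewrite /interior.
have [d1 d10 h1] : exists2 d, 0 < d &
    ball (set_val w.1) d `<=` ball (set_val z.1) e.
  have := @ball_open _ _ (set_val z.1) e; rewrite openE => /(_ _ b1).
  by rewrite /interior -nbhs_ballE => -[d /= d0 h]; exists d.
have [d2 d20 h2] : exists2 d, 0 < d &
    ball (set_val w.2 : R^o) d `<=` ball (set_val z.2 : R^o) e.
  have := @ball_open _ R^o (set_val z.2) e; rewrite openE => /(_ _ b2).
  by rewrite /interior -nbhs_ballE => -[d /= d0 h]; exists d.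
rewrite -nbhs_ballE; exists (Num.min d1 d2) => /=.
  by rewrite lt_min d10 d20.
move=> u; rewrite ball_dataE => -[/= u1 u2]; split.
- by apply: h1; apply: le_ball u1; rewrite ge_min lexx.
- by apply: h2; apply: le_ball u2; rewrite ge_min lexx orbT.
Qed.

Lemma measurable_enlargement A e :
  measurable (enlargement A e : set (borel Z)).
Proof.
apply: sub_sigma_algebra; apply: bigcup_open => a _; exact: open_ball_data.
Qed.

Lemma prokhorov_adm1 P Q : prokhorov_adm P Q 1.
Proof.
split=> // A mA; rewrite (le_trans (probability_le1 _ mA))//.
by rewrite leeDr// measure_ge0.
Qed.

Lemma prokhorov_has_inf P Q : has_inf (prokhorov_adm P Q).
Proof.
by split; [exists 1; exact: prokhorov_adm1|exists 0 => e [/ltW]].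
Qed.

Lemma prokhorov_adm_sym P Q : prokhorov_adm P Q `<=` prokhorov_adm Q P.
Proof.
move=> e [e0 h]; split=> // A mA.
have mAe := measurable_enlargement A e.
have := h _ (measurableC mAe); rewrite probability_setC//.
have sub : enlargement (~` enlargement A e) e `<=` ~` A.
  move=> z [w /= nw wz] Az; apply: nw; exists z => //; exact: ball_sym.
have : (Q (enlargement (~` enlargement A e) e) <= 1 - Q A)%E.
  rewrite -probability_setC//; apply: le_measure => //; rewrite inE.
  - exact: measurable_enlargement.
  - exact: measurableC.
rewrite -(fineK (fin_num_measure P _ mAe)) -(fineK (fin_num_measure Q _ mA)).
have mee := measurable_enlargement (~` enlargement A e) e.
rewrite -(fineK (fin_num_measure Q _ mee)).
rewrite -!EFinD !lee_fin; lra.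
Qed.

Lemma prokhorov_sym P Q : prokhorov P Q = prokhorov Q P.
Proof.
by congr inf; apply/seteqP; split; exact: prokhorov_adm_sym.
Qed.

Lemma prokhorovxx P : prokhorov P P = 0.
Proof.
apply/eqP; rewrite eq_le; apply/andP; split; last first.
  by apply: lb_le_inf; [case: (prokhorov_has_inf P P)|move=> e [/ltW]].
apply/ler_addgt0Pl => e e0; rewrite addr0; apply: ge_inf.
  by case: (prokhorov_has_inf P P).
split=> // A mA; rewrite (@le_trans _ _ (P (enlargement A e)))//.
  apply: le_measure; rewrite ?inE//; first exact: measurable_enlargement.
  by move=> z Az; exists z => //; exact: ballxx.
by rewrite leeDl// lee_fin ltW.
Qed.

Lemma prokhorov_triangle Q P S :
  prokhorov P S <= prokhorov P Q + prokhorov Q S.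
Proof.
apply/ler_addgt0Pl => e e0; have e20 : 0 < e / 2 by rewrite divr_gt0.
have [a [a0 ha] aP] := inf_adherent e20 (prokhorov_has_inf P Q).
have [b [b0 hb] bP] := inf_adherent e20 (prokhorov_has_inf Q S).
rewrite (@le_trans _ _ (a + b))//; last first.
  by move: aP bP; rewrite -!/(prokhorov _ _); lra.
apply: ge_inf; first by case: (prokhorov_has_inf P S).
split=> [|A mA]; first exact: addr_gt0.
have mAa := measurable_enlargement A a.
have mAab := measurable_enlargement (enlargement A a) b.
have SA : (S (enlargement (enlargement A a) b) <=
           S (enlargement A (a + b)))%E.
  apply: le_measure; rewrite ?inE//; first exact: measurable_enlargement.
  move=> z [w [v Av vw] wz]; exists v => //; exact: ball_triangle vw wz.
rewrite (le_trans (ha _ mA))// EFinD [(a%:E + _)%E]addeC addeA leeD2r//.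
by rewrite (le_trans (hb _ mAa))// leeD2r.
Qed.

End prokhorov.

Section phi_weak.
Context (R : realType) (E : normedModType R) (X : set E) (Y : set R).
Context (X0 : X !=set0) (Y0 : Y !=set0).
Local Notation Z := (data_space X0 Y0).
Variable phi : Z -> R.

Definition gauge : Prop :=
  [/\ continuous phi, (forall z, 0 <= phi z) &
      exists2 K : set Z, compact K & forall z, ~ K z -> 1 <= phi z].

Definition moment_space : Type :=
  set_type [set P : probability (borel Z) R |
             (\int[P]_z (phi z)%:E < +oo)%E].

HB.instance Definition _ := Choice.on moment_space.

Definition moment_val (P : moment_space) : probability (borel Z) R := \val P.

Definition phi_dist (P Q : moment_space) : R :=
  prokhorov (moment_val P) (moment_val Q) +
  `|\int[moment_val P]_z phi z - \int[moment_val Q]_z phi z|.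

Let phi_ball (P : moment_space) (e : R) := [set Q | phi_dist P Q < e].

Let phi_ent : set_system (moment_space * moment_space) := entourage_ phi_ball.

Let phi_nbhs (P : moment_space) : set_system moment_space := nbhs_ phi_ent P.

Let phi_nbhsE : phi_nbhs = nbhs_ phi_ent. Proof. by []. Qed.

HB.instance Definition _ := hasNbhs.Build moment_space phi_nbhs.

Let phi_ball_center P (e : R) : 0 < e -> phi_ball P e P.
Proof.
by move=> e0; rewrite /phi_ball/= /phi_dist prokhorovxx subrr normr0 addr0.
Qed.

Let phi_ball_sym P Q (e : R) : phi_ball P e Q -> phi_ball Q e P.
Proof. by rewrite /phi_ball/= /phi_dist prokhorov_sym distrC. Qed.

Let phi_ball_triangle P Q S e1 e2 :
  phi_ball P e1 Q -> phi_ball Q e2 S -> phi_ball P (e1 + e2) S.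
Proof.
rewrite /phi_ball/= /phi_dist => PQ QS.
apply: le_lt_trans (ltrD PQ QS); rewrite addrACA; apply: lerD.
  exact: prokhorov_triangle.
exact: ler_distD.
Qed.

Let phi_entE : phi_ent = entourage_ phi_ball. Proof. by []. Qed.

(* The topology induced by this pseudometric is the phi-weak topology. It is
   only a pseudometric because the values of [P : probability] on
   non-measurable sets are not determined by those on Borel sets. *)
HB.instance Definition _ := @Nbhs_isPseudoMetric.Build R moment_space
  phi_ent phi_nbhsE phi_ball phi_ball_center phi_ball_sym phi_ball_triangle
  phi_entE.

End phi_weak.

Section iid.
Context d (T : measurableType d) (R : realType) (P : probability T R).

Definition tuple_cons n (p : T * n.-tuple T) : n.+1.-tuple T :=
  [tuple of p.1 :: p.2].

Lemma measurable_tuple_cons n : measurable_fun setT (@tuple_cons n).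
Proof. exact: measurable_cons. Qed.

HB.instance Definition _ n := isMeasurableFun.Build _ _ _ _
  (@tuple_cons n) (@measurable_tuple_cons n).

(* N-fold product measure, see [iid_rectangle]. *)
Fixpoint iid n : probability (n.-tuple T) R :=
  match n with
  | 0 => dirac [tuple]
  | n'.+1 => distribution (P \x iid n')%E (@tuple_cons n')
  end.

Lemma measurable_rectangle n (A : 'I_n -> set T) :
  (forall i, measurable (A i)) ->
  measurable [set t : n.-tuple T | forall i, A i (tnth t i)].
Proof.
move=> mA; rewrite (_ : mkset _ =
    \bigcap_(i in [set: 'I_n]) ((fun t => tnth t i) @^-1` A i)).
  apply: (@fin_bigcap_measurable _ (n.-tuple T)); first exact: finite_finset.
  by move=> i _; rewrite -[X in measurable X]setTI; exact: measurable_tnth.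
by apply/seteqP; split => t /= h i; [move=> _|]; exact: h.
Qed.

Lemma iid_rectangle n (A : 'I_n -> set T) : (forall i, measurable (A i)) ->
  iid n [set t | forall i, A i (tnth t i)] = (\prod_(i < n) P (A i))%E.
Proof.
elim: n A => [|n IHn] A mA.
  by rewrite big_ord0 /= diracE mem_set// => -[].
have mA' i : measurable (A (lift ord0 i)) by exact: mA.
rewrite big_ord_recl -(IHn _ mA').
have mr := measurable_rectangle mA'.
rewrite -(product_measure1E P (iid n) (mA ord0) mr) /=.
rewrite /distribution /pushforward; congr (_ _).
apply/seteqP; split=> -[x t] /= h.
  split; first by have := h ord0; rewrite (tnth_nth x).
  by move=> i; have := h (lift ord0 i); rewrite !(tnth_nth x).
move=> i; case: h => h0 h; case: (unliftP ord0 i) => [j|] ->.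
  by have := h j; rewrite !(tnth_nth x).
by rewrite (tnth_nth x).
Qed.

End iid.

Section rkhs.
Context (R : realType) (X : Type).

Definition pd_kernel (k : X -> X -> R) : Prop :=
  (forall x x', k x x' = k x' x) /\
  forall (n : nat) (x : 'I_n -> X) (a : 'I_n -> R),
    0 <= \sum_(i < n) \sum_(j < n) a i * a j * k (x i) (x j).

(* The Hilbert space of functions with reproducing kernel [k]; it is unique, so
   quantifying over [rkhs k] amounts to fixing H_k. The inner product is only
   meaningful on [rkhs_set]. *)
Record rkhs (k : X -> X -> R) := Rkhs {
  rkhs_set :> set (X -> R);
  rkhs_dot : (X -> R) -> (X -> R) -> R;
  rkhs0 : rkhs_set 0;
  rkhsZD : forall (a : R) f g,
    rkhs_set f -> rkhs_set g -> rkhs_set (a *: f + g);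
  rkhs_dotC : forall f g, rkhs_set f -> rkhs_set g ->
    rkhs_dot f g = rkhs_dot g f;
  rkhs_dotZDl : forall (a : R) f g h,
    rkhs_set f -> rkhs_set g -> rkhs_set h ->
    rkhs_dot (a *: f + g) h = a * rkhs_dot f h + rkhs_dot g h;
  rkhs_dot_ge0 : forall f, rkhs_set f -> 0 <= rkhs_dot f f;
  rkhs_dot_eq0 : forall f, rkhs_set f -> rkhs_dot f f = 0 -> f = 0;
  rkhs_complete : forall u : nat -> X -> R, (forall n, rkhs_set (u n)) ->
    (forall e, 0 < e -> exists N, forall m n, (N <= m)%N -> (N <= n)%N ->
       Num.sqrt (rkhs_dot (u m - u n) (u m - u n)) < e) ->
    exists2 f, rkhs_set f & forall e, 0 < e -> exists N, forall n, (N <= n)%N ->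
       Num.sqrt (rkhs_dot (u n - f) (u n - f)) < e;
  rkhs_section : forall x, rkhs_set (k ^~ x);
  rkhs_reproducing : forall f x, rkhs_set f -> f x = rkhs_dot f (k ^~ x)
}.

Definition rkhs_norm k (H : rkhs k) (f : X -> R) : R :=
  Num.sqrt (rkhs_dot H f f).

Definition sup_norm (f : X -> R) : \bar R :=
  ereal_sup (range (fun x => `|f x|%:E)).

End rkhs.

Section risk.
Context (R : realType) (E : normedModType R) (X : set E) (Y : set R).
Context (X0 : X !=set0) (Y0 : Y !=set0).
Local Notation X' := (subspace_of X0).
Local Notation Y' := (subspace_of Y0).
Local Notation Z := (data_space X0 Y0).
Context (k : X' -> X' -> R) (H : rkhs k) (F : set (X' -> Y')).
Variable c : Z -> Y' -> R.

Definition real_fun (f : X' -> Y') : X' -> R := fun x => set_val (f x).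

Definition optimal_risk (P : probability (borel Z) R) : \bar R :=
  ereal_inf [set (\int[P]_z (c z (f z.1))%:E)%E | f in F].

Definition regularized_risk (N : nat) (t : N.-tuple (borel Z)) (lambda : R) :
  \bar R :=
  ereal_inf [set (N%:R^-1 * \sum_(i < N) c (tnth t i) (f (tnth t i).1) +
                  lambda * rkhs_norm H (real_fun f) ^+ 2)%:E | f in F].

End risk.

(* Main.v *)
(** Because of the reproducing property and the bound on the norms, [F] is
    equicontinuous and pointwise bounded; as the outputs lie in a complete set,
    continuity of [c] makes the losses [z |-> c z (f z.1)] an equicontinuous
    family dominated by [phi]. Cover the separable space [Z] by balls on which
    every loss oscillates by at most [eta]. Compactness of [M] for the Prokhorov
    metric yields finitely many of them that carry mass at least [1 - tau] for
    all [P] in [M] at once. On the disjointified balls all losses are nearly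
    constant, so their empirical means are controlled by finitely many
    empirical frequencies (Chebyshev); off the balls they are controlled by the
    tail of [phi], which is uniformly small by the [p]-th moment bound. This
    gives a random variable with small expectation that dominates
    [|P_N g - P g|] for all losses [g] simultaneously, and Markov's inequality
    concludes. *)

Require Import Defs.
From mathcomp Require Import all_boot all_order all_algebra.
From mathcomp Require Import ring lra.
From mathcomp Require Import all_classical all_reals all_analysis.
From mathcomp Require Import measurable_realfun.

Set Implicit Arguments.
Unset Strict Implicit.
Unset Printing Implicit Defensive.

Import Order.TTheory GRing.Theory Num.Theory.
Import numFieldNormedType.Exports.

Local Open Scope classical_set_scope.
Local Open Scope ring_scope.

(** * Reproducing kernel Hilbert spaces and equicontinuity of the losses *)

Section rkhs_theory.
Context (R : realType) (X : Type) (k : X -> X -> R) (H : rkhs k).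
Implicit Types f g : X -> R.

(** The quadratic [a |-> <a f + g, a f + g>] is nonnegative, in particular at its minimizer; if
    [<f, f> = 0], definiteness gives [f = 0]. *)
Lemma rkhs_cauchy_schwarz f g : rkhs_set H f -> rkhs_set H g ->
  `|rkhs_dot H f g| <= rkhs_norm H f * rkhs_norm H g.
Proof.
move=> Hf Hg; have ff0 := rkhs_dot_ge0 Hf.
suff sq : rkhs_dot H f g ^+ 2 <= rkhs_dot H f f * rkhs_dot H g g.
  by rewrite -sqrtr_sqr /rkhs_norm -sqrtrM// ler_wsqrtr.
have expand a : rkhs_dot H (a *: f + g) (a *: f + g) =
    a ^+ 2 * rkhs_dot H f f + 2 * a * rkhs_dot H f g + rkhs_dot H g g.
  have Hh := rkhsZD a Hf Hg.
  rewrite rkhs_dotZDl// (rkhs_dotC Hf Hh) (rkhs_dotC Hg Hh).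
  by rewrite !rkhs_dotZDl// (rkhs_dotC Hg Hf); ring.
have [ff_eq0|ff_neq0] := eqVneq (rkhs_dot H f f) 0; last first.
  have ff_gt0 : 0 < rkhs_dot H f f by rewrite lt_neqAle eq_sym ff_neq0.
  have := rkhs_dot_ge0 (rkhsZD (- (rkhs_dot H f g / rkhs_dot H f f)) Hf Hg).
  rewrite expand => /(mulr_ge0 ff0).
  rewrite [X in _ <= X -> _](_ : _ =
    rkhs_dot H f f * rkhs_dot H g g - rkhs_dot H f g ^+ 2) ?subr_ge0//.
  by field.
(* Linearity at the zero vector reads [<0, g> = <0, g> + <0, g>], whence [<0, g> = 0]. *)
have := rkhs_dotZDl 1 (rkhs0 H) (rkhs0 H) Hg.
rewrite scaler0 addr0 mul1r -{1}[rkhs_dot H 0 g]addr0 => /addrI dot0g.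
by rewrite (rkhs_dot_eq0 Hf ff_eq0) -dot0g expr0n mulr_ge0// rkhs_dot_ge0//;
  exact: rkhs0.
Qed.

Lemma rkhs_norm_ge0 f : 0 <= rkhs_norm H f.
Proof. exact: sqrtr_ge0. Qed.

Lemma rkhs_eval_bound f x : rkhs_set H f ->
  `|f x| <= rkhs_norm H f * rkhs_norm H (k ^~ x).
Proof.
by move=> Hf; rewrite (rkhs_reproducing x Hf) rkhs_cauchy_schwarz//;
  exact: rkhs_section.
Qed.

(** The increment is the inner product of [f] with [k(., x') - k(., x)], so a norm-bounded family
    inherits the modulus of continuity of the feature map. *)
Lemma rkhs_eval_lipschitz f x x' : rkhs_set H f ->
  `|f x' - f x| <= rkhs_norm H f * rkhs_norm H (fun u => k u x' - k u x).
Proof.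
move=> Hf; have Hk := rkhs_section H.
have kE : (fun u => k u x' - k u x) = (-1) *: (k ^~ x) + k ^~ x'.
  by apply/funext => u; rewrite !fctE /= scaleN1r addrC.
have Hd : rkhs_set H ((-1) *: (k ^~ x) + k ^~ x') by exact: rkhsZD.
rewrite kE (_ : f x' - f x = rkhs_dot H f ((-1) *: (k ^~ x) + k ^~ x')).
  exact: rkhs_cauchy_schwarz.
rewrite (rkhs_reproducing x Hf) (rkhs_reproducing x' Hf) (rkhs_dotC Hf Hd).
by rewrite rkhs_dotZDl// (rkhs_dotC Hf (Hk x)) (rkhs_dotC Hf (Hk x')); ring.
Qed.

End rkhs_theory.

(** A neighbourhood of the limit contains all but finitely many terms. Such sets are the compacts on
    which the kernel condition [Ka] is used. *)
Lemma compact_cvg_seq (T : topologicalType) (u : nat -> T) (l : T) :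
  u @ \oo --> l -> compact (l |` range u).
Proof.
move=> ul; apply/compact_near_coveringP => I F P FF cov.
have [[/= U Q] [lU FQ] UQP] := cov l (or_introl erefl).
have [n _ nU] := ul _ lU.
have fin : \forall i \near F, forall m, (m < n)%N -> P i (u m).
  elim: n {nU} => [|n IHn]; first by apply: nearW.
  have : \forall i \near F, P i (u n).
    have [[/= V S] [lV FS] VSP] := cov (u n) (or_intror (imageT u n)).
    apply: filterS FS => i Si; apply: (VSP (u n, i)); split => //=.
    exact: nbhs_singleton.
  apply: filterS2 IHn => i Pi Pn m; rewrite ltnS leq_eqVlt => /predU1P[->//|].
  exact: Pi.
apply: filterS2 FQ fin => i Qi fi x [->|[m _ <-]].
  by apply: (UQP (l, i)); split => //=; exact: nbhs_singleton.
have [/fi//|nm] := ltnP m n.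
by apply: (UQP (u m, i)); split => //=; exact: nU.
Qed.

(** Joint continuity gives a radius at each [(z, y)]; compactness of [C], as near-covering along
    radii decreasing to [0], makes it uniform in [y]. *)
Lemma continuous_tube (R : realType) (T U : pseudoMetricType R)
    (c : T -> U -> R) (C : set U) (z : T) (e : R) :
  continuous (fun zy : T * U => c zy.1 zy.2) -> compact C -> 0 < e ->
  exists2 r : R, 0 < r & forall w y y', ball z r w -> C y -> ball y r y' ->
    `|c w y' - c z y| < e.
Proof.
move=> cc /compact_near_coveringP cC e0.
have e20 : 0 < e / 2 by rewrite divr_gt0.
pose P (r : R) y := forall w y', ball z r w -> ball y r y' ->
  `|c w y' - c z y| < e.
have [|r /= r0 rP] := cC R (0^'+ : set_system R) P _.
  move=> y _; have := cc (z, y) _ (nbhsx_ballx (c z y) _ e20).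
  rewrite nbhs_simpl/= -nbhs_ballE => -[d /= d0 hd].
  have d20 : 0 < d / 2 by rewrite divr_gt0.
  have hd' w y' : ball z d w -> ball y d y' -> `|c z y - c w y'| < e / 2.
    by move=> zw yy'; apply: (hd (w, y')); split.
  (* Radii are halved so that a small ball around a point near [y] stays within distance [d] of
     [y]. *)
  exists (ball y (d / 2), [set r | r < d / 2]).
    by split; [exact: nbhsx_ballx|exact: nbhs_right_lt].
  move=> [y1 r] [/= yy1 rd] w y' zw y1y'.
  rewrite (le_lt_trans (ler_distD (c z y) _ _))// [e]splitr ltrD//.
    rewrite distrC; apply: hd'.
      apply: le_ball zw; rewrite ltW// (lt_trans rd)//.
      by rewrite gtr_pMr// invf_lt1 ?ltr1n.
    rewrite [d]splitr; apply: ball_triangle yy1 _.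
    by apply: le_ball y1y'; exact: ltW.
  apply: hd'; first exact: ballxx.
  by apply: le_ball yy1; rewrite ltW// gtr_pMr// invf_lt1 ?ltr1n.
exists (r / 2); first by rewrite divr_gt0.
move=> w y y' zw Cy yy'; apply: (rP (r / 2)) => //.
  by rewrite /= sub0r normrN gtr0_norm ?divr_gt0// gtr_pMr// invf_lt1 ?ltr1n.
by rewrite divr_gt0.
Qed.

Section equicontinuity.
Context (R : realType) (E : normedModType R) (X : set E) (Y : set R).
Context (X0 : X !=set0) (Y0 : Y !=set0).
Local Notation X' := (subspace_of X0).
Local Notation Y' := (subspace_of Y0).
Local Notation Z := (data_space X0 Y0).
Context (polishZ : polish Z) (k : X' -> X' -> R) (H : rkhs k).
Context (Ka : forall Z0 : set Z, compact Z0 ->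
     forall eps : R, 0 < eps -> exists2 eta : R, 0 < eta &
       forall x x' : X', (fst @` Z0) x -> (fst @` Z0) x' ->
         `|set_val x' - set_val x| < eta ->
         rkhs_norm H (fun u => k u x' - k u x) < eps).

(** [Ka] controls the kernel on compact sets only. If continuity failed at [x], some sequence
    tending to [x] would witness it, and this sequence together with [x] is compact. *)
Lemma feature_map_continuous (x : X') (e : R) : 0 < e ->
  exists2 r : R, 0 < r & forall x', ball x r x' ->
    rkhs_norm H (fun u => k u x' - k u x) < e.
Proof.
move=> e0; apply: contrapT => /forall2NP nr.
have step n : exists x', ball x n.+1%:R^-1 x' /\
    ~ rkhs_norm H (fun u => k u x' - k u x) < e.
  have [|/existsNP[x' /not_implyP[xx' h]]] := nr n.+1%:R^-1.
    by rewrite invr_gt0.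
  by exists x'.
have [u hu] := choice step.
(* [Ka] speaks of projections of compact subsets of [Z], so the inputs are paired with a fixed
   output. *)
pose v n : Z := (u n, point); pose l : Z := (x, point).
have vl : v @ \oo --> l.
  apply/cvg_ballP => d d0; near=> n.
  split => /=; last exact: ballxx.
  apply: le_ball (hu n).1; rewrite ltW//.
  by near: n; exact: near_infty_natSinv_lt (PosNum d0).
have [eta eta0 h] := Ka (compact_cvg_seq vl) e0.
have [n _ hn] : \forall n \near \oo, n.+1%:R^-1 < eta.
  exact: near_infty_natSinv_lt (PosNum eta0).
apply: (hu n).2; apply: h.
- by exists l => //; left.
- by exists (v n) => //; right; exists n.
- rewrite distrC.
  have := (hu n).1 : ball (set_val x) n.+1%:R^-1 (set_val (u n)).
  by rewrite -ball_normE => xun; exact: lt_trans xun (hn n (leqnn _)).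
Unshelve. all: by end_near. Qed.

(** [Y] is not assumed closed. An ultrafilter of bounded outputs converges to a real [b], hence is
    Cauchy, and completeness of [Z] provides a limit inside [Y]. *)
Lemma output_bounded_compact (B : R) :
  compact [set y : Y' | `|set_val y| <= B].
Proof.
rewrite compact_ultra => U UU UB.
have PU : ProperFilter U by exact: ultra_proper.
have vB : U (set_val @^-1` `[- B, B]%classic).
  by apply: filterS UB => y /=; rewrite in_itv/= -ler_norml.
have [b [_ clb]] := @segment_compact R (- B) B (set_val @ U) _ vB.
have Ub (e : R) : 0 < e -> U [set y | `|b - set_val y| < e].
  move=> e0.
  (* An ultrafilter contains the ball around [b] or its complement; the latter contradicts that [b]
     is a cluster point. *)
  have [//|nU] := in_ultra_setVsetC [set y | `|b - set_val y| < e] UU.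
  have [w [/= w1 w2]] := clb (~` ball b e) (ball b e) nU (nbhsx_ballx b e e0).
  by have := w1 w2.
pose G : set_system Z := (fun y => (point, y) : Z) @ U.
have PG : ProperFilter G by exact: fmap_proper_filter.
have cG : cauchy G.
  apply: cauchy_exP => e e0.
  have e20 : 0 < e / 2 by rewrite divr_gt0.
  have [y by_] := filter_ex (Ub _ e20); exists (point, y).
  suff: U [set y' | ball ((point, y) : Z) e ((point, y') : Z)] by [].
  apply: filterS (Ub _ e20) => y' /= by'; split => /=; first exact: ballxx.
  suff : `|set_val y - set_val y'| < e by [].
  rewrite (le_lt_trans (ler_distD b _ _))// [e]splitr ltrD//.
  by rewrite distrC; exact: by_.
have [z Gz] := polishZ.2 G PG cG.
have near_z (e : R) : 0 < e -> U (ball z.2 e).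
  move=> e0; have : G (ball z e) by apply: Gz; exact: nbhsx_ballx.
  move=> Gze; suff: U [set y | ball z e ((point, y) : Z)].
    by apply: filterS => y [].
  by [].
exists z.2; split.
  apply/ler_addgt0Pr => e e0.
  have [y [yB yz]] := filter_ex (filterI UB (near_z _ e0)).
  have /= yz' : `|set_val z.2 - set_val y| < e := yz.
  move: yB yz' => /= yB /ltW yz'.
  rewrite -[set_val z.2](subrK (set_val y)) addrC.
  by rewrite (le_trans (ler_normD _ _))// lerD.
move=> V; rewrite -nbhs_ballE => -[e /= e0 eV].
exact: filterS eV (near_z _ e0).
Qed.

(** All outputs [f z.1] lie in one compact set by the norm bound, and nearby outputs are close
    uniformly in [f]; joint continuity of [c] around that set does the rest. *)
Lemma cost_equicontinuous (F : set (X' -> Y')) (c : Z -> Y' -> R) (beta : R) :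
  (forall f, F f -> rkhs_set H (real_fun f)) ->
  (forall f, F f -> rkhs_norm H (real_fun f) <= beta) ->
  continuous (fun zy : Z * Y' => c zy.1 zy.2) -> 0 < beta ->
  forall (z : Z) (e : R), 0 < e -> exists2 r : R, 0 < r &
    forall f, F f -> forall w, ball z r w ->
      `|c w (f w.1) - c z (f z.1)| < e.
Proof.
move=> FH Kb cc beta0 z e e0.
have cC := @output_bounded_compact (beta * rkhs_norm H (k ^~ z.1)).
have [r r0 tube] := continuous_tube z cc cC e0.
(* The modulus [r / beta] makes outputs move by less than [r], since all norms are at most
   [beta]. *)
have [s s0 hs] := feature_map_continuous z.1 (divr_gt0 r0 beta0).
exists (Num.min r s); first by rewrite lt_min r0.
move=> f Ff w zw; apply: tube.
- by apply: le_ball zw; rewrite ge_min lexx.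
- rewrite /= (le_trans (rkhs_eval_bound z.1 (FH _ Ff)))//.
  by rewrite ler_wpM2r ?rkhs_norm_ge0// Kb.
- suff : `|real_fun f w.1 - real_fun f z.1| < r by rewrite distrC.
  rewrite (le_lt_trans (rkhs_eval_lipschitz _ _ (FH _ Ff)))//.
  rewrite (@le_lt_trans _ _
    (beta * rkhs_norm H (fun u => k u w.1 - k u z.1)))//.
    by rewrite ler_wpM2r ?rkhs_norm_ge0// Kb.
  rewrite mulrC -ltr_pdivlMr//; apply: hs.
  have zw1 : ball z.1 (Num.min r s) w.1 := zw.1.
  by apply: le_ball zw1; rewrite ge_min lexx orbT.
Qed.

End equicontinuity.

(** * Empirical means under the product measure *)

Section iid_theory.
Context d (T : measurableType d) (R : realType) (P : probability T R).
Variable n : nat.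
Implicit Types (i j : 'I_n) (A : set T) (t : n.-tuple T).

Lemma measurable_coord i A : measurable A ->
  measurable [set t | A (tnth t i)].
Proof.
by move=> mA; rewrite -[X in measurable X]setTI; exact: measurable_tnth.
Qed.

(** The event is a rectangle whose other sides are the whole space; the same holds for two
    coordinates below, which is all the independence needed for variances. *)
Lemma iid_coord i A : measurable A -> iid P n [set t | A (tnth t i)] = P A.
Proof.
move=> mA; pose B j := if j == i then A else setT.
rewrite (_ : mkset _ = [set t | forall j, B j (tnth t j)]); last first.
  apply/seteqP; split => t /=; last by move=> /(_ i); rewrite /B eqxx.
  by move=> At j; rewrite /B; case: eqP => // ->.
rewrite iid_rectangle; last by move=> j; rewrite /B; case: ifP.
rewrite (bigD1 i)//= /B eqxx big1 ?mule1// => j /negbTE ->.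
exact: probability_setT.
Qed.

Lemma iid_coord2 i j A B : i != j -> measurable A -> measurable B ->
  iid P n [set t | A (tnth t i) /\ B (tnth t j)] = (P A * P B)%E.
Proof.
move=> ij mA mB; pose C l := if l == i then A else if l == j then B else setT.
rewrite (_ : mkset _ = [set t | forall l, C l (tnth t l)]); last first.
  apply/seteqP; split => t /=.
    by move=> [At Bt] l; rewrite /C; case: eqP => [->//|_]; case: eqP => [->|].
  move=> h; split; first by have := h i; rewrite /C eqxx.
  by have := h j; rewrite /C eq_sym (negbTE ij) eqxx.
rewrite iid_rectangle; last first.
  by move=> l; rewrite /C; case: ifP => // _; case: ifP.
rewrite (bigD1 i)//= (bigD1 j) ?[j == i]eq_sym//= /C eqxx eq_sym (negbTE ij).
rewrite eqxx big1 ?mule1// => l /andP[/negbTE -> /negbTE ->].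
exact: probability_setT.
Qed.

Lemma measurable_fun_coord i (f : T -> \bar R) : measurable_fun setT f ->
  measurable_fun setT (fun t => f (tnth t i)).
Proof.
by move=> mf; apply: (measurableT_comp mf); exact: measurable_tnth.
Qed.

(** Change of variables along the coordinate map, whose image measure agrees with [P] on measurable
    sets. *)
Lemma integral_iid_coord i (f : T -> \bar R) : measurable_fun setT f ->
  (forall x, 0 <= f x)%E ->
  (\int[iid P n]_t f (tnth t i) = \int[P]_x f x)%E.
Proof.
move=> mf f0.
have mi : measurable_fun setT (fun t : n.-tuple T => tnth t i).
  exact: measurable_tnth.
have := @ge0_integral_pushforward _ _ _ _ R _ mi (iid P n) setT f
  measurableT mf.
rewrite preimage_setT => <-; last by move=> x _; exact: f0.
apply: eq_measure_integral => A mA _.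
exact: iid_coord.
Qed.

(** The integral of [f] against the empirical measure; it is [0] for the empty sample, as
    [0^-1 = 0]. *)
Definition sample_mean (f : T -> R) t : R :=
  n%:R^-1 * \sum_(i < n) f (tnth t i).

Lemma measurable_sample_mean (f : T -> R) : measurable_fun setT f ->
  measurable_fun setT (sample_mean f).
Proof.
move=> mf; apply: measurable_funM; first exact: measurable_cst.
apply: measurable_sum => i.
by apply: (measurableT_comp mf); exact: measurable_tnth.
Qed.

Lemma integral_sample_mean (f : T -> R) : (0 < n)%N -> measurable_fun setT f ->
  (forall x, 0 <= f x) ->
  (\int[iid P n]_t (sample_mean f t)%:E = \int[P]_x (f x)%:E)%E.
Proof.
move=> n0 mf f0; have mEf : measurable_fun setT (EFin \o f).
  exact/measurable_EFinP.
under eq_integral do rewrite /sample_mean EFinM -sumEFin.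
rewrite ge0_integralZl//; last 2 first.
  - by apply: emeasurable_sum => i; exact: (measurable_fun_coord i mEf).
  - by move=> t _; apply: sume_ge0 => i _; rewrite lee_fin.
rewrite ge0_integral_sum//; last 2 first.
  - by move=> i; exact: (measurable_fun_coord i mEf).
  - by move=> i t _; rewrite lee_fin.
rewrite (eq_bigr (fun=> 1%:E * \int[P]_x (f x)%:E))%E; last first.
  by move=> i _; rewrite mul1e; exact: (integral_iid_coord i mEf).
rewrite -ge0_sume_distrl// sumEFin sumr_const card_ord muleA -EFinM.
rewrite mulVf ?mul1e//.
by rewrite pnatr_eq0 -lt0n.
Qed.

Lemma indic_coord A i t : \1_A (tnth t i) = \1_[set u | A (tnth u i)] t :> R.
Proof. by rewrite !indicE. Qed.

(** The square is a double sum of indicators of pairs: the [n] diagonal terms have mean [P A], the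
    [n^2 - n] others [(P A)^2] by independence. *)
Lemma integral_count_sq A : measurable A ->
  (\int[iid P n]_t ((\sum_(i < n) \1_A (tnth t i)) ^+ 2)%:E =
   (n%:R * fine (P A) + (n%:R ^+ 2 - n%:R) * fine (P A) ^+ 2)%:E)%E.
Proof.
move=> mA; set a := fine (P A).
have PA : P A = a%:E by rewrite fineK ?fin_num_measure.
pose B i j : set (n.-tuple T) := [set t | A (tnth t i) /\ A (tnth t j)].
have mB i j : measurable (B i j).
  exact: measurableI (measurable_coord i mA) (measurable_coord j mA).
have PB i j : iid P n (B i j) = (if i == j then a else a ^+ 2)%:E.
  case: eqP => [<-|/eqP ij].
    rewrite -PA -(iid_coord i mA); congr (iid P n _).
    by apply/seteqP; split => t /=; [case|].
  by rewrite iid_coord2// PA -EFinM.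
have sq t : (\sum_(i < n) \1_A (tnth t i)) ^+ 2 =
    \sum_(i < n) \sum_(j < n) \1_(B i j) t :> R.
  rewrite expr2 mulr_suml; apply: eq_bigr => i _.
  rewrite mulr_sumr; apply: eq_bigr => j _.
  rewrite !indic_coord -[LHS]/((\1_ _ \* \1_ _) t) -indicI.
  by congr (\1_ _ t).
under eq_integral do rewrite sq -sumEFin.
have mE i j : measurable_fun setT (fun t => (\1_(B i j) t)%:E : \bar R).
  by apply/measurable_EFinP; exact: measurable_indic.
rewrite ge0_integral_sum//; last 2 first.
  - move=> i; under eq_fun do rewrite -sumEFin.
    exact: emeasurable_sum.
  - by move=> i t _; rewrite lee_fin sumr_ge0.
transitivity (\sum_(i < n) \sum_(j < n) (if i == j then a else a ^+ 2)%:E)%E.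
  apply: eq_bigr => i _; under eq_integral do rewrite -sumEFin.
  rewrite ge0_integral_sum//.
  by apply: eq_bigr => j _; rewrite integral_indic// setIT; exact: PB.
under eq_bigr do rewrite sumEFin.
rewrite sumEFin; congr EFin.
rewrite (eq_bigr (fun=> a + (n%:R - 1) * a ^+ 2)); last first.
  move=> i _; rewrite (bigD1 i)//= eqxx; congr (_ + _).
  rewrite (eq_bigr (fun=> a ^+ 2)); last first.
    by move=> j /negbTE; rewrite eq_sym => ->.
  rewrite sumr_const cardC1 card_ord -[LHS]mulr_natl -subn1 natrB//.
  by rewrite (leq_ltn_trans _ (ltn_ord i)).
by rewrite sumr_const card_ord -[LHS]mulr_natl; ring.
Qed.

Lemma sample_frequency_variance A : (0 < n)%N -> measurable A ->
  (\int[iid P n]_t ((sample_mean \1_A t - fine (P A)) ^+ 2)%:E <= n%:R^-1%:E)%E.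
Proof.
move=> n0 mA; set a := fine (P A).
have nR : n%:R != 0 :> R by rewrite pnatr_eq0 -lt0n.
have a0 : 0 <= a by rewrite fine_ge0.
have a1 : a <= 1.
  by rewrite -lee_fin fineK ?fin_num_measure// probability_le1.
have PA : P A = a%:E by rewrite fineK ?fin_num_measure.
have m1 : measurable_fun setT (\1_A : T -> R) by exact: measurable_indic.
have mm := measurable_sample_mean m1.
have mS : measurable_fun setT (fun t => \sum_(i < n) \1_A (tnth t i) : R).
  apply: measurable_sum => i.
  by apply: (measurableT_comp m1); exact: measurable_tnth.
have mV : measurable_fun setT
    (fun t => ((sample_mean \1_A t - a) ^+ 2)%:E : \bar R).
  by apply/measurable_EFinP; apply: measurable_funX; exact: measurable_funB.
have mm2 : measurable_fun setT
    (fun t => (2 * a * sample_mean \1_A t)%:E : \bar R).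
  by apply/measurable_EFinP; exact: measurable_funM.
have mS2 : measurable_fun setT
    (fun t => ((\sum_(i < n) \1_A (tnth t i)) ^+ 2)%:E : \bar R).
  by apply/measurable_EFinP; exact: measurable_funX.
have mean0 t : 0 <= 2 * a * sample_mean \1_A t.
  by rewrite !mulr_ge0// ?invr_ge0// sumr_ge0.
set V := (\int[_]_t _)%E.
(* The square is expanded with its cross term moved to the left, so that only integrals of
   nonnegative functions occur. *)
have : (V + \int[iid P n]_t (2 * a * sample_mean \1_A t)%:E =
  (n%:R^-2)%:E * \int[iid P n]_t ((\sum_(i < n) \1_A (tnth t i)) ^+ 2)%:E +
  (a ^+ 2)%:E)%E.
  rewrite -ge0_integralD//; [|by move=> t _; rewrite lee_fin ?sqr_ge0..].
  rewrite -ge0_integralZl//; last by move=> t _; rewrite lee_fin sqr_ge0.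
  rewrite -[X in _ = (_ + X)%E]mule1 -(probability_setT (iid P n)).
  rewrite -integral_cst// -ge0_integralD//; last 3 first.
  - by move=> t _; rewrite -EFinM lee_fin mulr_ge0 ?invr_ge0 ?sqr_ge0.
  - exact: measurable_funeM.
  - by move=> t _; rewrite lee_fin sqr_ge0.
  apply: eq_integral => t _; rewrite -EFinM -!EFinD; congr EFin.
  by rewrite /sample_mean; field.
rewrite integral_count_sq// -/a.
rewrite (_ : \int[_]_t _ = (2 * a * a)%:E)%E; last first.
  under eq_integral do rewrite EFinM.
  rewrite ge0_integralZl//; last 3 first.
  - exact/measurable_EFinP.
  - by move=> t _; rewrite lee_fin mulr_ge0// sumr_ge0.
  - by rewrite lee_fin mulr_ge0.
  rewrite integral_sample_mean// integral_indic// setIT [X in (_ * X)%E]PA.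
  by rewrite -EFinM.
rewrite -EFinM -EFinD => VE.
have -> : V = (a / n%:R - a ^+ 2 / n%:R)%:E.
  have /(congr1 (fun x => x - (2 * a * a)%:E)%E) := VE.
  rewrite addeK// => ->; rewrite -EFinB; congr EFin.
  by field.
rewrite lee_fin -mulrBl -[leRHS]mul1r ler_wpM2r ?invr_ge0//.
by rewrite (le_trans _ a1)// gerBl sqr_ge0.
Qed.

(** The variance bound controls the first absolute moment; the free parameter [s] is later balanced
    against [n]. *)
Lemma sample_frequency_deviation A (s : R) : (0 < n)%N -> measurable A ->
  0 < s ->
  (\int[iid P n]_t `|sample_mean \1_A t - fine (P A)|%:E <=
    (s + (s * n%:R)^-1)%:E)%E.
Proof.
move=> n0 mA s0; have s0' : 0 <= s^-1 by rewrite invr_ge0 ltW.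
have m1 : measurable_fun setT (\1_A : T -> R) by exact: measurable_indic.
have mm := measurable_sample_mean m1.
have mD : measurable_fun setT (fun t => sample_mean \1_A t - fine (P A)).
  exact: measurable_funB.
have mV : measurable_fun setT
    (fun t => ((sample_mean \1_A t - fine (P A)) ^+ 2)%:E : \bar R).
  by apply/measurable_EFinP; exact: measurable_funX.
apply: (@le_trans _ _ (\int[iid P n]_t (s%:E +
    s^-1%:E * ((sample_mean \1_A t - fine (P A)) ^+ 2)%:E))%E).
  apply: ge0_le_integral => //.
  - by apply/measurable_EFinP; exact: measurableT_comp.
  - by apply: emeasurable_funD => //; exact: measurable_funeM.
  move=> t _; rewrite -EFinM -EFinD lee_fin.
  (* AM-GM in the weak form [|x| <= s + x^2 / s] *)
  set x := _ - _; rewrite -(real_normK (num_real x)).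
  have : 0 <= s^-1 * (`|x| - s) ^+ 2 by rewrite mulr_ge0// sqr_ge0.
  rewrite (_ : _ * _ = s^-1 * `|x| ^+ 2 - `|x| + s - `|x|); last first.
    by field; rewrite gt_eqF.
  by have := normr_ge0 x; lra.
rewrite ge0_integralD//; last 3 first.
- by move=> t _; rewrite lee_fin ltW.
- by move=> t _; rewrite -EFinM lee_fin mulr_ge0// sqr_ge0.
- exact: measurable_funeM.
rewrite integral_cst//= probability_setT mule1 ge0_integralZl//; last first.
  by move=> t _; rewrite lee_fin sqr_ge0.
rewrite EFinD leeD2l// invfM EFinM lee_wpmul2l ?lee_fin//.
exact: sample_frequency_variance.
Qed.

End iid_theory.

(** * Measurability on the data space *)

Section borel_data_space.
Context (R : realType) (E : normedModType R) (X : set E) (Y : set R).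
Context (X0 : X !=set0) (Y0 : Y !=set0).
Local Notation Z := (data_space X0 Y0).

Lemma open_borel (A : set Z) : open A -> measurable (A : set (borel Z)).
Proof. exact: sub_sigma_algebra. Qed.

Lemma continuous_borel (f : Z -> R) : continuous f ->
  measurable_fun setT (f : borel Z -> R).
Proof.
move=> cf; apply: (measurability (@RGenOInfty.G R)).
  exact: RGenOInfty.measurableE.
move=> _ [_ [a ->] <-]; rewrite setTI; apply: open_borel.
apply: open_comp => //; rewrite set_itvE; exact: gt_open.
Qed.

Lemma dense_sequence : (exists2 D : set Z, countable D & dense D) ->
  exists e : nat -> Z, forall z (r : R), 0 < r -> exists n, ball z r (e n).
Proof.
move=> [D /countable_injP[f finj] dD].
(* Indices outside the range of the injection, such as when [D] is finite, get the default value
   [point]. *)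
have step n : exists z : Z, forall d, D d -> f d = n -> z = d.
  have [[d Dd fd]|nd] := pselect (exists2 d, D d & f d = n).
    by exists d => d' Dd' fd'; apply: finj; rewrite ?inE// fd'.
  by exists point => d Dd fd; case: nd; exists d.
have [e he] := choice step; exists e => z r r0.
have [||d [zd Dd]] := dD (ball z r); first by exists z; exact: ballxx.
  exact: open_ball_data.
by exists (f d); rewrite (he _ _ Dd erefl).
Qed.

(* An open set of tuples is a countable union of boxes of balls with centers in
   a dense sequence, hence lies in the product sigma-algebra. *)
Lemma open_tuple_measurable N (O : set (N.-tuple (borel Z))) :
  (exists2 D : set Z, countable D & dense D) ->
  (forall t, O t -> exists2 r : R, 0 < r &
    forall u : N.-tuple (borel Z),
      (forall i, ball (tnth t i : Z) r (tnth u i)) -> O u) ->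
  measurable O.
Proof.
move=> /dense_sequence[e he] oO.
pose box (i : (N.-tuple nat * nat)%type) : set (N.-tuple (borel Z)) :=
  [set u | forall j, ball (e (tnth i.1 j)) i.2.+1%:R^-1 (tnth u j)].
have mbox i : measurable (box i).
  apply: (@measurable_rectangle _ (borel Z) N
    (fun j => ball (e (tnth i.1 j)) i.2.+1%:R^-1)) => j.
  by apply: open_borel; exact: open_ball_data.
(* Boxes not contained in [O] are replaced by the empty set, so the union runs over a whole
   countable type. *)
rewrite (_ : O = \bigcup_i (if `[< box i `<=` O >] then box i else set0)).
  apply: countable_bigcupT_measurable => // i.
  by case: ifP => _; [exact: mbox|exact: measurable0].
apply/seteqP; split => [t Ot|t [i _]]; last by case: asboolP => // h /h.
have [r r0 hr] := oO t Ot.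
have [n nr] : exists n, n.+1%:R^-1 < r / 2.
  have [n _ hn] := near_infty_natSinv_lt (PosNum (divr_gt0 r0 (ltr0n R 2))).
  by exists n; exact: hn n (leqnn n).
have n0 : 0 < n.+1%:R^-1 :> R by rewrite invr_gt0.
have [s hs] := choice (fun j => he (tnth t j) _ n0).
have ts j : ball (tnth t j : Z) n.+1%:R^-1 (e (tnth (mktuple s) j)).
  by rewrite tnth_mktuple.
exists (mktuple s, n) => //; case: asboolP => [_ j|[]] /=.
  by apply: ball_sym; exact: ts.
move=> u hu; apply: hr => j; rewrite [r]splitr.
by apply: ball_triangle (le_ball (ltW nr) (ts j)) (le_ball (ltW nr) (hu j)).
Qed.

(** The infimum runs over a possibly uncountable [F], but [inf < a] means that some objective is
    [< a]; this is a union of open sets of tuples, hence open. *)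
Lemma measurable_regularized_risk (k : subspace_of X0 -> subspace_of X0 -> R)
    (H : rkhs k) (F : set (subspace_of X0 -> subspace_of Y0))
    (c : Z -> subspace_of Y0 -> R) N (lambda : R) :
  (exists2 D : set Z, countable D & dense D) ->
  (forall f, F f -> continuous (fun z : Z => c z (f z.1))) ->
  measurable_fun setT
    (fun t : N.-tuple (borel Z) => regularized_risk H F c t lambda).
Proof.
move=> sepZ cF; apply: (measurability (@ErealGenCInfty.G R)).
  exact: ErealGenCInfty.measurableE.
move=> _ [_ [a ->] <-]; rewrite setTI.
pose J f (t : N.-tuple (borel Z)) : R :=
  N%:R^-1 * \sum_(i < N) c (tnth t i) (f (tnth t i).1) +
  lambda * rkhs_norm H (real_fun f) ^+ 2.
rewrite (_ : _ @^-1` _ = ~` [set t | exists2 f, F f & J f t < a]); last first.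
  apply/seteqP; split => t /=; rewrite in_itv/= andbT.
    move=> h [f Ff]; apply/negP; rewrite -leNgt -lee_fin (le_trans h)//.
    by apply: ereal_inf_lbound; exists f.
  move=> h; apply: le_ereal_inf_tmp => _ [f Ff <-].
  rewrite lee_fin leNgt; apply/negP => Ja; apply: h; exists f => //.
apply: measurableC; apply: open_tuple_measurable => // t [f Ff Jfa].
pose d := a - J f t.
have d0 : 0 < d by rewrite subr_gt0.
have step (i : 'I_N) : exists r : R, 0 < r /\ forall w : Z,
    ball (tnth t i : Z) r w ->
    `|c (tnth t i) (f (tnth t i).1) - c w (f w.1)| < d / 2.
  have := cF f Ff (tnth t i) _
    (nbhsx_ballx _ (d / 2) (divr_gt0 d0 (ltr0n R 2))).
  by rewrite nbhs_simpl/= -nbhs_ballE => -[r /= r0 hr]; exists r.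
have [r hr] := choice step.
(* The initial value [1] keeps the minimum positive even for the empty tuple. *)
pose r' := \big[Order.min/1]_(i < N) r i.
exists r'.
  by apply/bigmin_gtP; split => // i _; exact: (hr i).1.
move=> u tu; exists f => //.
suff : `|J f u - J f t| <= d / 2.
  rewrite ler_norml => /andP[_]; rewrite lerBlDr => /le_lt_trans; apply.
  by rewrite -ltrBrDr -/d ltr_pdivrMr// mulr_natr mulr2n ltrDl.
rewrite /J opprD addrACA subrr addr0 -mulrBr -sumrB normrM.
rewrite ger0_norm ?invr_ge0//.
have [N0|N0] := posnP N.
  have -> : N%:R^-1 = 0 :> R by rewrite N0 invr0.
  by rewrite mul0r divr_ge0// ltW.
rewrite ler_pdivrMl ?ltr0n// (le_trans (ler_norm_sum _ _ _))//.
rewrite (@le_trans _ _ (\sum_(i < N) d / 2))//.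
  apply: ler_sum => i _; rewrite distrC ltW//; apply: (hr i).2.
  by apply: le_ball (tu i); exact: bigmin_le_cond.
by rewrite sumr_const card_ord mulr_natl.
Qed.

End borel_data_space.

(** * Uniform tightness *)

Section tightness.
Context (R : realType) (E : normedModType R) (X : set E) (Y : set R).
Context (X0 : X !=set0) (Y0 : Y !=set0).
Local Notation Z := (data_space X0 Y0).
Variables (phi : Z -> R) (M : set (probability (borel Z) R)).

(* The doubled radii absorb the enlargement in the Prokhorov metric. *)
Lemma tight_cover (w : nat -> Z) (rho : nat -> R) (I : set nat) (tau : R) :
  (forall P, M P -> (\int[P]_z (phi z)%:E < +oo)%E) ->
  compact [set P : moment_space phi | M (moment_val P)] ->
  (forall j, 0 < rho j) ->
  (forall z, exists2 j, I j & ball (w j) (rho j) z) ->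
  0 < tau ->
  exists m, forall P, M P ->
    ((1 - tau)%:E <=
      P (\bigcup_(j in `I_m `&` I) ball (w j) (rho j + rho j)))%E.
Proof.
move=> Mphi /compact_near_coveringP cM rho0 cover tau0.
pose V (m : nat) : set Z :=
  \bigcup_(j in `I_m `&` I) ball (w j) (rho j + rho j).
pose V' (m : nat) : set Z := \bigcup_(j in `I_m `&` I) ball (w j) (rho j).
have mV m : measurable (V m : set (borel Z)).
  by apply: open_borel; apply: bigcup_open => j _; exact: open_ball_data.
have mV' m : measurable (V' m : set (borel Z)).
  by apply: open_borel; apply: bigcup_open => j _; exact: open_ball_data.
have V_homo m n : (m <= n)%N -> V m `<=` V n.
  move=> mn z [j [jm Ij] jz]; exists j => //; split => //.
  exact: leq_trans jm mn.
pose Q m (P : moment_space phi) := ((1 - tau)%:E <= moment_val P (V m))%E.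
(* Near-covering along [m] tending to infinity turns a bound valid near each [P] into one [m] for
   all of [M]. *)
have [|m _ hm] := cM nat (\oo : set_system nat) Q _.
  move=> P MP; have tau20 : 0 < tau / 2 by rewrite divr_gt0.
  have V'T : \bigcup_m V' m = setT.
    apply/seteqP; split => // z _; have [j Ij jz] := cover z.
    by exists j.+1 => //; exists j => //; split => //=.
  (* Continuity from below: the unions [V' m] increase to the whole space. *)
  have [m0 Pm0] : exists m, ((1 - tau / 2)%:E < moment_val P (V' m))%E.
    have mT : measurable (\bigcup_m V' m : set (borel Z)) by rewrite V'T.
    have V'_homo : {homo V' : n m / (n <= m)%N >-> (n <= m)%O}.
      move=> m n mn; apply/subsetPset => z [j [jm Ij] jz].
      by exists j => //; split => //; exact: leq_trans jm mn.
    have := @nondecreasing_cvg_mu _ _ _ (moment_val P) V' mV' mT V'_homo.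
    rewrite V'T [X in _ --> X]probability_setT => PV.
    have /PV[n _ hn] : nbhs 1%E [set x : \bar R | ((1 - tau / 2)%:E < x)%E].
      by apply: open_nbhs_nbhs; split; [exact: open_ereal_gt_ereal|
        rewrite /= lte_fin gtrBl].
    by exists n; exact: (hn n (leqnn n)).
  (* Below [tau / 2] for the loss of mass, and below the finitely many radii so that enlarged balls
     stay in the doubled ones. *)
  pose a := Num.min (tau / 2) (\big[Order.min/1]_(j < m0) rho j).
  have a0 : 0 < a.
    by rewrite lt_min tau20; apply/bigmin_gtP; split => // j _; exact: rho0.
  exists (ball P a, [set m | (m0 <= m)%N]).
    by split; [exact: nbhsx_ballx|exists m0].
  move=> [P' m] [/= PP' m0m]; rewrite /Q.
  have PP'a : phi_dist P P' < a := PP'.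
  have : prokhorov (moment_val P) (moment_val P') < a.
    by apply: le_lt_trans PP'a; rewrite /phi_dist lerDl.
  move=> /inf_lt[|s [s0 adm] sa]; first exact: (prokhorov_has_inf _ _).1.
  have sub : enlargement (V' m0) s `<=` V m.
    move=> z [u [j [jm Ij] ju] uz]; exists j.
      by split => //; exact: leq_trans jm m0m.
    apply: ball_triangle ju _; apply: le_ball uz.
    rewrite ltW// (lt_le_trans sa)//.
    rewrite ge_min; apply/orP; right.
    exact: (@bigmin_le_cond _ _ _ 1 (Ordinal jm) xpredT (fun j => rho j)).
  have PV : (moment_val P (V' m0) <= moment_val P' (V m) + (tau / 2)%:E)%E.
    rewrite (le_trans (adm _ (mV' m0)))// leeD//; last first.
      by rewrite lee_fin ltW// (lt_le_trans sa)// ge_min lexx.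
    by apply: le_measure; rewrite ?inE//; exact: measurable_enlargement.
  have := lt_le_trans Pm0 PV.
  rewrite -(fineK (fin_num_measure (moment_val P') _ (mV m))) -EFinD lte_fin.
  by rewrite lee_fin; lra.
exists m => P MP.
have Pphi :
    [set P : probability (borel Z) R | (\int[P]_z (phi z)%:E < +oo)%E] P.
  exact: Mphi.
pose P' : moment_space phi := exist _ P (mem_set Pphi).
exact: (hm m (leqnn m) P' MP).
Qed.

End tightness.

(** * Deviation of a dominated family *)

Section uniform_law.
Context d (T : measurableType d) (R : realType) (P : probability T R).
Variables (phi : T -> R) (m : nat) (A : 'I_m -> set T) (w : 'I_m -> T).
Variable eta : R.
Hypotheses (mphi : measurable_fun setT phi) (phi0 : forall z, 0 <= phi z)
  (iphi : P.-integrable setT (EFin \o phi)) (mA : forall j, measurable (A j))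
  (tA : trivIset setT A) (eta0 : 0 <= eta).

(** Bounds the error of replacing a loss by its values at the centers: [eta] on the cells, at most
    [phi] off them. *)
Definition envelope (z : T) : R :=
  eta + phi z * \1_(~` \bigcup_j A j) z.
Local Notation h := envelope.

Lemma measurable_envelope : measurable_fun setT h.
Proof.
apply: measurable_funD => //; apply: measurable_funM => //.
apply: measurable_indic; apply: measurableC.
by apply: fin_bigcup_measurable => //; exact: finite_finset.
Qed.

Lemma envelope_ge0 z : 0 <= h z.
Proof. by rewrite addr_ge0// mulr_ge0. Qed.

Lemma integrable_envelope : P.-integrable setT (EFin \o h).
Proof.
apply: (@le_integrable _ _ _ _ _ _ _ (EFin \o (fun z => eta + phi z))) => //.
- by apply/measurable_EFinP; exact: measurable_envelope.
- move=> z _ /=; have hz := envelope_ge0 z.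
  rewrite lee_fin !ger0_norm// ?addr_ge0//.
  by rewrite lerD2l indicE; case: (_ \in _); rewrite ?mulr1// mulr0.
- have -> : EFin \o (fun z => eta + phi z) = (EFin \o cst eta) \+ (EFin \o phi).
    by apply/funext => z /=; rewrite EFinD.
  by apply: integrableD => //; exact: finite_measure_integrable_cst.
Qed.

(** Approximation error under the empirical measure and under [P], plus the deviations of the cell
    frequencies weighted by [phi (w j)]. It does not depend on the loss, so no supremum over the
    family has to be integrated. *)
Definition law_dev n (t : n.-tuple T) : R :=
  sample_mean h t + \int[P]_z h z +
  \sum_(j < m) phi (w j) * `|sample_mean \1_(A j) t - fine (P (A j))|.

Lemma law_dev_ge0 n (t : n.-tuple T) : 0 <= law_dev t.
Proof.
rewrite addr_ge0//; last by apply: sumr_ge0 => j _; rewrite mulr_ge0.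
rewrite addr_ge0//; last by apply: Rintegral_ge0 => z _; exact: envelope_ge0.
by rewrite mulr_ge0// sumr_ge0// => i _; exact: envelope_ge0.
Qed.

Lemma sample_mean_le_dev n (t : n.-tuple T) (g : T -> R) :
  measurable_fun setT g -> (forall z, 0 <= g z <= phi z) ->
  (forall j z, A j z -> `|g z - g (w j)| <= eta) ->
  `|sample_mean g t - \int[P]_z g z| <= law_dev t.
Proof.
move=> mg gphi gosc.
have ih := integrable_envelope.
have g0 z : 0 <= g z by have /andP[] := gphi z.
(* The step function taking the value of [g] at the center of each cell and [0] off the cells; all
   three error terms pass through it. *)
pose s z := \sum_(j < m) g (w j) * \1_(A j) z.
have gsh z : `|g z - s z| <= h z.
  have [Wz|/contrapT[j0 _ Aj0]] := pselect ((~` \bigcup_j A j) z).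
    rewrite /s big1 ?subr0; last first.
      move=> j _; rewrite indicE memNset ?mulr0// => Ajz.
      by apply: Wz; exists j.
    rewrite ger0_norm// /envelope indicE mem_set// mulr1.
    by have /andP[_ /le_trans->] := gphi z; rewrite ?lerDr.
  rewrite /s (bigD1 j0)//= big1 ?addr0; last first.
    move=> j jj0; rewrite indicE memNset ?mulr0// => Ajz.
    by move: jj0; rewrite (tA I I (ex_intro _ z (conj Ajz Aj0))) eqxx.
  rewrite indicE mem_set// mulr1 (le_trans (gosc _ _ Aj0))// /h.
  by rewrite lerDl mulr_ge0.
have is_ : P.-integrable setT (EFin \o s).
  have -> : EFin \o s = (fun z => \sum_(j < m) (g (w j) * \1_(A j) z)%:E)%E.
    by apply/funext => z; rewrite /= sumEFin.
  apply: integrable_sum => // j _.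
  have -> : (fun z => (g (w j) * \1_(A j) z)%:E) =
      (fun z => (g (w j))%:E * (\1_(A j) z)%:E)%E.
    by apply/funext => z; rewrite EFinM.
  by apply: integrableZl => //; exact: integrable_indic.
have ig : P.-integrable setT (EFin \o g).
  apply: (le_integrable _ _ _ iphi) => //; first exact/measurable_EFinP.
  move=> z _ /=; rewrite lee_fin !ger0_norm//.
  by have /andP[] := gphi z.
have Ps : \int[P]_z s z = \sum_(j < m) g (w j) * fine (P (A j)).
  rewrite /Rintegral; under eq_integral do rewrite -sumEFin.
  rewrite integral_sum//; last first.
    move=> j; under eq_fun do rewrite EFinM.
    by apply: integrableZl => //; exact: integrable_indic.
  rewrite (eq_bigr (fun j => (g (w j) * fine (P (A j)))%:E)); last first.
    move=> j _; under eq_integral do rewrite EFinM.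
    rewrite integralZl//; last exact: integrable_indic.
    by rewrite integral_indic// setIT EFinM fineK// fin_num_measure.
  by rewrite sumEFin.
have mean_gs : `|sample_mean g t - sample_mean s t| <= sample_mean h t.
  rewrite /sample_mean -mulrBr -sumrB normrM ger0_norm ?invr_ge0//.
  rewrite ler_wpM2l ?invr_ge0// (le_trans (ler_norm_sum _ _ _))//.
  by apply: ler_sum.
have int_gs : `|\int[P]_z s z - \int[P]_z g z| <= \int[P]_z h z.
  have igs : P.-integrable setT (EFin \o (fun z => g z - s z)).
    rewrite (_ : _ \o _ = (fun z => (g z)%:E - (s z)%:E)%E).
      exact: integrableB.
    by apply/funext => z /=; rewrite EFinB.
  rewrite distrC -RintegralB// (le_trans (le_normr_Rintegral _ igs))//.
  by apply: le_Rintegral => //; exact: integrable_norm.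
have mean_s : sample_mean s t = \sum_(j < m) g (w j) * sample_mean \1_(A j) t.
  rewrite /sample_mean exchange_big/= mulr_sumr; apply: eq_bigr => j _.
  by rewrite -mulr_sumr mulrCA.
rewrite (_ : _ - _ = sample_mean g t - sample_mean s t +
  (\int[P]_z s z - \int[P]_z g z) + (sample_mean s t - \int[P]_z s z));
  last by ring.
rewrite (le_trans (ler_normD _ _))// lerD//.
  by rewrite (le_trans (ler_normD _ _))// lerD.
rewrite mean_s Ps -sumrB (le_trans (ler_norm_sum _ _ _))//.
apply: ler_sum => j _; rewrite -mulrBr normrM ger0_norm// ler_wpM2r//.
by have /andP[] := gphi (w j).
Qed.

Lemma measurable_law_dev n : measurable_fun setT (@law_dev n).
Proof.
have mh := measurable_envelope.
apply: measurable_funD.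
  by apply: measurable_funD => //; exact: measurable_sample_mean.
apply: measurable_sum => j; apply: measurable_funM => //.
apply: measurableT_comp => //; apply: measurable_funB => //.
by apply: measurable_sample_mean; exact: measurable_indic.
Qed.

(** The sample mean of the envelope has the expectation of the envelope, whence the factor [2]; each
    cell frequency contributes its deviation bound. *)
Lemma integral_law_dev n (s : R) : (0 < n)%N -> 0 < s ->
  (\int[iid P n]_t (law_dev t)%:E <=
   (2 * \int[P]_z h z +
    (s + (s * n%:R)^-1) * \sum_(j < m) phi (w j))%:E)%E.
Proof.
have [[mh ih] h0] := (measurable_envelope, integrable_envelope, envelope_ge0).
move=> n0 s_gt0; have s0 := ltW s_gt0.
have s0' : 0 <= s + (s * n%:R)^-1 by rewrite addr_ge0// invr_ge0 mulr_ge0.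
have Ph : (\int[P]_z (h z)%:E = (\int[P]_z h z)%:E)%E.
  by rewrite /Rintegral fineK// integrable_fin_num.
have Ph0 : 0 <= \int[P]_z h z by apply: Rintegral_ge0.
pose D j (t : n.-tuple T) := `|sample_mean \1_(A j) t - fine (P (A j))|.
have mD j : measurable_fun setT (fun t => (D j t)%:E : \bar R).
  apply/measurable_EFinP; apply: measurableT_comp => //.
  apply: measurable_funB => //.
  by apply: measurable_sample_mean; exact: measurable_indic.
have mpD j : measurable_fun setT (fun t => ((phi (w j))%:E * (D j t)%:E)%E).
  exact: measurable_funeM.
have mmh : measurable_fun setT
    (fun t : n.-tuple T => (sample_mean h t)%:E : \bar R).
  by apply/measurable_EFinP; exact: measurable_sample_mean.
have mh0 (t : n.-tuple T) : (0 <= (sample_mean h t)%:E :> \bar R)%E.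
  by rewrite lee_fin mulr_ge0// sumr_ge0.
have pD0 j t : (0 <= (phi (w j))%:E * (D j t)%:E)%E.
  by apply: mule_ge0; rewrite lee_fin ?phi0 ?normr_ge0.
under eq_integral.
  move=> t _; rewrite /law_dev !EFinD -sumEFin.
  under eq_bigr do rewrite EFinM.
  over.
rewrite ge0_integralD//; last 4 first.
- by move=> t _; rewrite adde_ge0// lee_fin.
- exact: emeasurable_funD.
- by move=> t _; apply: sume_ge0 => j _; exact: pD0.
- exact: emeasurable_sum.
rewrite ge0_integralD//.
rewrite integral_sample_mean// Ph integral_cst//= probability_setT mule1.
rewrite -EFinD -mulr2n -[_ *+ 2]mulr_natl [leRHS]EFinD leeD2l//.
rewrite (ge0_integral_sum _ measurableT mpD (fun j t _ => pD0 j t)).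
rewrite mulr_sumr -sumEFin; apply: lee_sum => j _.
rewrite (ge0_integralZl _ measurableT (mD j))// ?lee_fin//; last first.
  by move=> t _; rewrite lee_fin /D normr_ge0.
rewrite mulrC EFinM lee_wpmul2l ?lee_fin//.
exact: sample_frequency_deviation.
Qed.


End uniform_law.

(** * Uniform law of large numbers *)

(** For [x > a], [x = x^(1 - p) x^p <= a^(1 - p) x^p] because [1 - p < 0]. *)
Lemma powR_truncation (R : realType) (p a x : R) : 1 < p -> 0 < a -> 0 <= x ->
  x <= a + a `^ (1 - p) * x `^ p.
Proof.
move=> p1 a0 x0; have [xa|ax] := leP x a.
  by rewrite (le_trans xa)// lerDl mulr_ge0// powR_ge0.
apply: ler_wpDl; first exact: ltW.
have x_gt0 : 0 < x := lt_trans a0 ax.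
have -> : x `^ p = x * x `^ (p - 1).
  rewrite -{2}[x]powRr1// -powRD; first by rewrite addrC subrK.
  by apply/implyP => _; rewrite gt_eqF.
rewrite mulrCA ler_peMr// -(opprB p) powRN ler_pdivlMl ?powR_gt0// mulr1.
by apply: ge0_ler_powR; rewrite ?nnegrE ?subr_ge0 ltW.
Qed.

(** Quantitative uniform integrability: the part of [phi] below level [a] contributes at most
    [a * tau], the part above is paid for by the [p]-th moment. *)
Lemma moment_truncation d (T : measurableType d) (R : realType)
    (P : probability T R) (phi : T -> R) (W : set T) (p kappa a tau : R) :
  measurable_fun setT phi -> (forall z, 0 <= phi z) -> measurable W ->
  1 < p -> 0 < a -> (\int[P]_z (phi z `^ p)%:E <= kappa%:E)%E ->
  (P W <= tau%:E)%E ->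
  (\int[P]_z (phi z * \1_W z)%:E <= (a * tau + a `^ (1 - p) * kappa)%:E)%E.
Proof.
move=> mphi phi0 mW p1 a0 mom PW.
have m1 : measurable_fun setT (\1_W : T -> R) by exact: measurable_indic.
have mp : measurable_fun setT (fun z => (phi z `^ p)%:E : \bar R).
  by apply/measurable_EFinP; exact: measurableT_comp (measurable_powR _) mphi.
apply: (@le_trans _ _ (\int[P]_z (a%:E * (\1_W z)%:E +
    (a `^ (1 - p))%:E * (phi z `^ p)%:E))%E).
  apply: ge0_le_integral => //.
  - by move=> z _; rewrite lee_fin mulr_ge0.
  - by apply/measurable_EFinP; exact: measurable_funM.
  - apply: emeasurable_funD; apply: measurable_funeM => //.
    exact/measurable_EFinP.
  move=> z _; rewrite -!EFinM -EFinD lee_fin indicE.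
  case: (_ \in _); rewrite ?mulr1 ?mulr0 ?add0r; first exact: powR_truncation.
  by rewrite mulr_ge0 ?powR_ge0.
rewrite ge0_integralD//.
- rewrite !ge0_integralZl//.
  + rewrite integral_indic// setIT EFinD EFinM [(a `^ _ * _)%:E]EFinM.
    by rewrite leeD// lee_wpmul2l ?lee_fin ?powR_ge0// ltW.
  + by move=> z _; rewrite lee_fin powR_ge0.
  + by rewrite lee_fin powR_ge0.
  + exact/measurable_EFinP.
  + by rewrite lee_fin ltW.
- by move=> z _; rewrite -EFinM lee_fin mulr_ge0// ltW.
- by apply: measurable_funeM => //; exact/measurable_EFinP.
- by move=> z _; rewrite -EFinM lee_fin mulr_ge0 ?powR_ge0.
- exact: measurable_funeM.
Qed.

Section uniform_law_of_large_numbers.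
Context (R : realType) (E : normedModType R) (X : set E) (Y : set R).
Context (X0 : X !=set0) (Y0 : Y !=set0).
Local Notation Z := (data_space X0 Y0).
Hypothesis sepZ : exists2 D : set Z, countable D & dense D.
Variable G : set (Z -> R).
Hypothesis equiG : forall (z : Z) (e : R), 0 < e -> exists2 r : R, 0 < r &
  forall g, G g -> forall w, ball z r w -> `|g w - g z| < e.

(** The balls have centers in a dense sequence and radii [1 / (n + 1)]; [I] selects those whose
    doubled ball has small oscillation for the whole family. *)
Lemma equicontinuous_cover (eta : R) : 0 < eta ->
  exists (w : nat -> Z) (rho : nat -> R) (I : set nat),
  [/\ forall j, 0 < rho j,
      forall z, exists2 j, I j & ball (w j) (rho j) z &
      forall j, I j -> forall g, G g -> forall z,
        ball (w j) (rho j + rho j) z -> `|g z - g (w j)| <= eta].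
Proof.
move=> eta0; have [e he] := dense_sequence sepZ.
pose ij m : nat * nat := odflt (0, 0)%N (unpickle m).
pose w m := e (ij m).1; pose rho m : R := (ij m).2.+1%:R^-1.
exists w, rho, [set j | forall g, G g -> forall z,
  ball (w j) (rho j + rho j) z -> `|g z - g (w j)| <= eta].
split => // [j|z]; first by rewrite /rho invr_gt0.
have eta20 : 0 < eta / 2 by rewrite divr_gt0.
have [r r0 hr] := equiG z eta20.
(* The center is within one radius of [z] and the doubled ball adds two more, hence the factor
   [3]. *)
have [n nr] : exists n, n.+1%:R^-1 < r / 3.
  have [n _ hn] := near_infty_natSinv_lt (PosNum (divr_gt0 r0 (ltr0n R 3))).
  by exists n; exact: hn n (leqnn n).
have n0 : 0 < n.+1%:R^-1 :> R by rewrite invr_gt0.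
have [i zi] := he z _ n0.
have ijE : ij (pickle (i, n)) = (i, n) by rewrite /ij pickleK.
exists (pickle (i, n)); rewrite /= /w /rho ijE /=; last exact: ball_sym.
move=> g Gg u ui.
have zu : ball z r u.
  apply: le_ball (ball_triangle zi ui).
  by move: nr; move: (n.+1%:R^-1 : R) => d nr; lra.
have ze : ball z r (e i).
  by apply: le_ball zi; rewrite (le_trans (ltW nr))//; lra.
rewrite (le_trans (ler_distD (g z) _ _))// [eta]splitr lerD// ltW//.
  exact: hr.
by rewrite distrC; exact: hr.
Qed.

Variables (phi : Z -> R) (M : set (probability (borel Z) R)) (p kappa : R).
Hypotheses (phi_cont : continuous phi) (phi0 : forall z, 0 <= phi z).
Hypothesis G_le : forall g, G g -> forall z, 0 <= g z <= phi z.
Hypotheses (p_gt1 : 1 < p) (kappa_gt0 : 0 < kappa).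
Hypothesis M_moment : forall P, M P -> (\int[P]_z (phi z `^ p)%:E < kappa%:E)%E.
Hypothesis M_compact : compact [set P : moment_space phi | M (moment_val P)].

Lemma family_continuous g : G g -> continuous g.
Proof.
move=> Gg z A; rewrite -nbhs_ballE => -[e /= e0 eA].
have [r r0 hr] := equiG z e0.
rewrite nbhs_simpl/= -nbhs_ballE; exists r => // w zw; apply: eA.
suff : `|g z - g w| < e by [].
by rewrite distrC; exact: hr.
Qed.

(** The truncation bound with [W] the whole space, level [1] and mass [1]. *)
Lemma moment_integrable (P : probability (borel Z) R) : M P ->
  P.-integrable setT (EFin \o phi).
Proof.
move=> MP; have mphi := continuous_borel phi_cont.
apply/integrableP; split; first exact/measurable_EFinP.
under eq_integral => z _.
  rewrite /= ger0_norm// (_ : phi z = phi z * \1_[set: Z] z); last first.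
    by rewrite indicT mulr1.
  over.
have PT : (P setT <= 1%:E)%E by rewrite probability_setT.
have mom := ltW (M_moment MP).
apply: le_lt_trans (moment_truncation mphi phi0 _ p_gt1 ltr01 mom PT) _ => //.
exact: ltry.
Qed.

(** Cells, centers and [N0] come from a tightness bound common to all of [M], so only [D] depends on
    [P]. *)
Lemma uniform_law (q : R) : 0 < q -> exists2 N0, (0 < N0)%N &
  forall N, (N0 <= N)%N -> forall P, M P ->
  exists D : N.-tuple (borel Z) -> R,
  [/\ measurable_fun setT D, forall t, 0 <= D t,
      (\int[iid P N]_t (D t)%:E <= q%:E)%E &
      forall g, G g -> forall t,
        `|sample_mean (g : borel Z -> R) t - \int[P]_z g z| <= D t].
Proof.
move=> q0; have mphi := continuous_borel phi_cont.
have q16 : 0 < q / 16 by rewrite divr_gt0.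
have [w [rho [J [rho0 cover osc]]]] := equicontinuous_cover q16.
(* Solves [a^(1 - p) * kappa = q / 16]; [tau] below is then chosen with [a * tau = q / 16]. *)
pose a : R := (16 * kappa / q) `^ (p - 1)^-1.
have a0 : 0 < a by rewrite powR_gt0// divr_gt0// mulr_gt0.
have aE : a `^ (1 - p) * kappa = q / 16.
  rewrite /a -powRrM -(opprB p 1) mulrN mulVf ?subr_eq0 ?gt_eqF//.
  rewrite powRN powRr1; last by rewrite divr_ge0 ?mulr_ge0 ?ltW.
  by field; rewrite !gt_eqF.
pose tau := q / 16 / a.
have tau0 : 0 < tau by rewrite divr_gt0.
have M1 P : M P -> (\int[P]_z (phi z)%:E < +oo)%E.
  by move=> MP; have := integrable_lty measurableT (moment_integrable MP).
have [m tight] := tight_cover M1 M_compact rho0 cover tau0.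
(* Rejected indices give empty sets, so that the family can be disjointified along all of [nat]. *)
pose V (j : nat) : set (borel Z) :=
  if `[< J j >] then ball (w j) (rho j + rho j) else set0.
have mV j : measurable (V j).
  rewrite /V; case: ifP => _; last exact: measurable0.
  by apply: open_borel; exact: open_ball_data.
pose A (j : 'I_m) : set (borel Z) := seqDU V j.
have mA j : measurable (A j) by exact: seqDU_measurable.
have tA : trivIset setT A.
  move=> i j _ _ ij; apply: val_inj; exact: (trivIset_seqDU V) ij.
have AU : \bigcup_j A j = \bigcup_(j in `I_m `&` J) ball (w j) (rho j + rho j).
  transitivity (\bigcup_(j < m) V j).
    rewrite bigcup_mkord bigsetU_seqDU -bigcup_mkord.
    apply/seteqP; split => [z [j _ Ajz]|z [j jm Ajz]]; first by exists j => /=.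
    by exists (Ordinal jm).
  apply/seteqP; split => [z [j jm]|z [j [jm Jj] jz]].
    by rewrite /V; case: asboolP => // Jj jz; exists j.
  by exists j => //; rewrite /V; case: asboolP.
pose S := \sum_(j < m) phi (w j).
have S0 : 0 <= S by apply: sumr_ge0.
(* Ensures [s * S <= q / 4]; the summand [1] avoids a zero denominator. Next, [N0 > s^-2] gives
   [1 / (s * N) <= s]. *)
pose s := q / (4 * (S + 1)).
have s0 : 0 < s by rewrite divr_gt0// mulr_gt0// ltr_wpDl.
pose N0 := (Num.truncn (s^-1 ^+ 2)).+1.
exists N0 => // N N0N P MP.
have N_gt0 : (0 < N)%N by exact: leq_trans N0N.
have iphi := moment_integrable MP.
exists (@law_dev _ _ R P phi m A w (q / 16) N).
have mU : measurable (\bigcup_j A j : set (borel Z)).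
  by apply: fin_bigcup_measurable => //; exact: finite_finset.
have mW := measurableC mU.
have PW : (P (~` \bigcup_j A j) <= tau%:E)%E.
  rewrite probability_setC//.
  by rewrite leeBlDr ?fin_num_measure// addeC -leeBlDr// AU -EFinB tight.
have Ph : \int[P]_z envelope (phi : borel Z -> R) A (q / 16) z <= 3 * (q / 16).
  have PhE : (\int[P]_z (envelope (phi : borel Z -> R) A (q / 16) z)%:E <=
      (3 * (q / 16))%:E)%E.
    have -> : 3 * (q / 16) = q / 16 + (a * tau + a `^ (1 - p) * kappa).
      by rewrite aE /tau; field; rewrite gt_eqF.
    rewrite /envelope; under eq_integral do rewrite EFinD.
    rewrite ge0_integralD//; last 3 first.
    - by move=> z _; rewrite lee_fin ltW.
    - by move=> z _; rewrite lee_fin mulr_ge0.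
    - by apply/measurable_EFinP; exact: measurable_funM.
    rewrite integral_cst//= probability_setT mule1 EFinD leeD2l//.
    by apply: moment_truncation => //; exact: ltW (M_moment MP).
  rewrite -lee_fin /Rintegral fineK// ge0_fin_numE ?(le_lt_trans PhE) ?ltry//.
  by apply: integral_ge0 => z _; rewrite lee_fin envelope_ge0// ltW.
split.
- exact: measurable_law_dev.
- by move=> t; apply: law_dev_ge0 => //; exact: ltW.
- apply: le_trans (integral_law_dev _ mphi phi0 iphi mA (ltW q16) N_gt0 s0) _.
  rewrite lee_fin -/S.
  have sN : (s * N%:R)^-1 <= s.
    have N0R : s^-1 ^+ 2 < N%:R.
      by rewrite (lt_le_trans (truncnS_gt _))// ler_nat.
    rewrite invfM ler_pdivrMr ?ltr0n// mulrC -ler_pdivrMr// -expr2.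
    exact: ltW.
  have sS : s * S <= q / 4.
    rewrite (@le_trans _ _ (s * (S + 1)))// ?ler_pM2l// ?lerDl//.
    rewrite /s le_eqVlt; apply/orP; left; apply/eqP; field.
    by rewrite gt_eqF// ltr_wpDl.
  (* The total is at most [2 * (3 q / 16) + 2 * (q / 4) = 7 q / 8]. *)
  have : (s * N%:R)^-1 * S <= s * S by rewrite ler_wpM2r.
  by rewrite mulrDl; lra.
- move=> g Gg t; apply: (sample_mean_le_dev mphi phi0 iphi mA tA (ltW q16)).
  + exact: continuous_borel (family_continuous Gg).
  + exact: G_le.
  + move=> j z Ajz; have : V j z by case: Ajz.
    by rewrite /V; case: asboolP => // Jj jz; exact: osc.
Qed.

End uniform_law_of_large_numbers.

(** * Consistency of the regularized risk *)

(** Nonnegativity and [F] nonempty make both infima finite, so the comparison takes place between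
    real infima. *)
Lemma ereal_inf_dist (R : realType) (I : Type) (F : set I) (a b : I -> R)
    (d : R) :
  F !=set0 -> (forall i, F i -> 0 <= a i) -> (forall i, F i -> 0 <= b i) ->
  (forall i, F i -> `|a i - b i| <= d) ->
  (`|ereal_inf [set (a i)%:E | i in F] - ereal_inf [set (b i)%:E | i in F]| <=
   d%:E)%E.
Proof.
move=> [i0 Fi0] a0 b0 ab.
have lb (u : I -> R) : (forall i, F i -> 0 <= u i) -> has_lbound (u @` F).
  by move=> u0; exists 0 => _ [i Fi <-]; exact: u0.
have ne (u : I -> R) : u @` F !=set0 by exists (u i0); exists i0.
have infE (u : I -> R) : (forall i, F i -> 0 <= u i) ->
    ereal_inf [set (u i)%:E | i in F] = (inf (u @` F))%:E.
  move=> u0; rewrite -ereal_inf_EFin//; last exact: lb.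
  by rewrite image_comp.
have infB (u v : I -> R) : (forall i, F i -> 0 <= u i) ->
    (forall i, F i -> `|u i - v i| <= d) -> inf (u @` F) - d <= inf (v @` F).
  move=> u0 uv; apply: lb_le_inf => // _ [i Fi <-].
  have ui : inf (u @` F) <= u i by apply: ge_inf; [exact: lb|exists i].
  by have := uv i Fi; rewrite ler_norml => /andP[_]; lra.
rewrite !infE// -EFinB lee_fin ler_distl -(lerBlDr _ d) infB//=; last first.
  by move=> i Fi; rewrite distrC ab.
by rewrite infB.
Qed.

(** Integrate [a * \1_A <= D]. *)
Lemma markov_bound d (T : measurableType d) (R : realType)
    (P : probability T R) (A : set T) (D : T -> R) (a e : R) :
  measurable A -> measurable_fun setT D -> (forall t, 0 <= D t) -> 0 < a ->
  (forall t, A t -> a <= D t) -> (\int[P]_t (D t)%:E <= (e * a)%:E)%E ->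
  (P A <= e%:E)%E.
Proof.
move=> mA mD D0 a0 AD iD.
rewrite -(@lee_pmul2l _ a%:E)// -EFinM [a * e]mulrC; apply: le_trans iD.
rewrite -[A]setIT -integral_indic// -ge0_integralZl//; last 2 first.
- by apply/measurable_EFinP; exact: measurable_indic.
- by rewrite lee_fin ltW.
apply: ge0_le_integral => //.
- by move=> t _; rewrite -EFinM lee_fin mulr_ge0// ltW.
- by apply: measurable_funeM; apply/measurable_EFinP; exact: measurable_indic.
- by apply/measurable_EFinP.
move=> t _; rewrite -EFinM lee_fin indicE.
have [/set_mem At|_] := boolP (t \in A); first by rewrite mulr1 AD.
by rewrite mulr0.
Qed.

Theorem theorem5p2 (R : realType) (E : normedModType R)
  (X : set E) (Y : set R) (X0 : X !=set0) (Y0 : Y !=set0)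
  (polishZ : polish (data_space X0 Y0))
  (k : subspace_of X0 -> subspace_of X0 -> R) (pdk : pd_kernel k)
  (H : rkhs k)
  (F : set (subspace_of X0 -> subspace_of Y0)) (F0 : F !=set0)
  (FH : forall f, F f -> rkhs_set H (real_fun f))
  (c : data_space X0 Y0 -> subspace_of Y0 -> R)
  (c_ge0 : forall f, F f -> forall z : data_space X0 Y0, 0 <= c z (f z.1))
  (Ka : forall Z0 : set (data_space X0 Y0), compact Z0 ->
     forall eps : R, 0 < eps -> exists2 eta : R, 0 < eta &
       forall x x' : subspace_of X0, (fst @` Z0) x -> (fst @` Z0) x' ->
         `|set_val x' - set_val x| < eta ->
         rkhs_norm H (fun u => k u x' - k u x) < eps)
  (beta : R) (beta_gt0 : 0 < beta)
  (Kb : forall f, F f -> rkhs_norm H (real_fun f) <= beta)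
  (phi : data_space X0 Y0 -> R) (gauge_phi : gauge phi)
  (Ca_bound : forall f, F f ->
     forall z : data_space X0 Y0, c z (f z.1) <= phi z)
  (Ca_growth : forall a : R, exists b : R,
     forall z : data_space X0 Y0, b < data_norm z -> a < phi z)
  (Cb : continuous
     (fun zy : data_space X0 Y0 * subspace_of Y0 => c zy.1 zy.2))
  (r : borel (data_space X0 Y0) -> R) (r_meas : measurable_fun setT r)
  (r_ge0 : forall z, 0 <= r z)
  (nu : R) (nu_gt0 : 0 < nu) (nu_le1 : nu <= 1)
  (Hold : forall f g, F f -> F g -> forall z : data_space X0 Y0,
     (`|c z (f z.1) - c z (g z.1)|%:E <=
      (r z)%:E *
      poweR (sup_norm (fun x => real_fun f x - real_fun g x)%R) nu)%E)
  (p kappa : R) (p_gt1 : 1 < p) (kappa_gt0 : 0 < kappa)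
  (M : set (probability (borel (data_space X0 Y0)) R))
  (M_moment : forall P, M P -> (\int[P]_z (phi z `^ p)%:E < kappa%:E)%E)
  (M_compact : compact [set P : moment_space phi | M (moment_val P)])
  (eps delta : R) (eps_gt0 : 0 < eps) (delta_gt0 : 0 < delta) :
  exists N0 : nat, forall (N : nat) (lambda : R), (N0 <= N)%N ->
    0 < lambda -> lambda <= delta / (4 * beta ^+ 2) ->
    (ereal_sup
       [set iid P N [set t | delta%:E <=
              `|regularized_risk H F c t lambda - optimal_risk F c P|]
       | P in M] <= eps%:E)%E.
Proof.
have sepZ := polishZ.1.
have [phi_cont phi0 _] := gauge_phi.
pose risk_fun f (z : data_space X0 Y0) : R := c z (f z.1).
pose G := risk_fun @` F.
have equiG z (e : R) : 0 < e -> exists2 r0 : R, 0 < r0 &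
    forall g, G g -> forall w, ball z r0 w -> `|g w - g z| < e.
  move=> /(cost_equicontinuous polishZ Ka FH Kb Cb beta_gt0 z)[r0 r00 h].
  by exists r0 => // _ [f Ff <-] w zw; exact: h.
have G_le g : G g -> forall z, 0 <= g z <= phi z.
  by move=> [f Ff <-] z; rewrite /risk_fun c_ge0//= Ca_bound.
(* Markov's inequality is applied at level [delta / 2]: on the bad event
   [D >= delta - delta / 4]. *)
have q0 : 0 < eps * (delta / 2) by rewrite mulr_gt0// divr_gt0.
have [N0 N0_gt0 law] := uniform_law sepZ equiG phi_cont phi0 G_le p_gt1
  kappa_gt0 M_moment M_compact q0.
exists N0 => N lambda N0N lambda0 lambda_le.
apply: ge_ereal_sup => _ [P MP <-].
have [D [mD D0 iD devD]] := law N N0N P MP.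
have mG f : F f -> continuous (risk_fun f).
  by move=> Ff; apply: (family_continuous equiG); exists f.
(* Losses are integrable, being dominated by [phi], so the expected losses are real numbers. *)
have opt_int f : F f ->
    (\int[P]_z (c z (f z.1))%:E)%E = (\int[P]_z risk_fun f z)%:E.
  move=> Ff; rewrite /Rintegral fineK//; apply: integrable_fin_num => //.
  apply: (le_integrable measurableT _ _ (moment_integrable phi_cont phi0 p_gt1
    M_moment MP)).
    by apply/measurable_EFinP; exact: continuous_borel (mG f Ff).
  by move=> z _ /=; rewrite lee_fin !ger0_norm ?c_ge0// Ca_bound.
have optE : optimal_risk F c P =
    ereal_inf [set (\int[P]_z risk_fun f z)%:E | f in F].
  by congr ereal_inf; exact: eq_imagel.
have dist t : (`|regularized_risk H F c t lambda - optimal_risk F c P| <=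
    (D t + delta / 4)%:E)%E.
  rewrite optE; apply: ereal_inf_dist => // f Ff;
    have nf0 := rkhs_norm_ge0 H (real_fun f); have pen0 :
      0 <= lambda * rkhs_norm H (real_fun f) ^+ 2 by rewrite !mulr_ge0// ltW.
  - rewrite addr_ge0// mulr_ge0//.
    by apply: sumr_ge0 => i _; exact: c_ge0.
  - by apply: Rintegral_ge0 => z _; exact: c_ge0.
  - rewrite addrAC (le_trans (ler_normD _ _))// lerD//.
      by apply: devD; exists f.
    rewrite ger0_norm//.
    (* The penalty is at most [lambda * beta^2 <= delta / 4]. *)
    rewrite (@le_trans _ _ (lambda * beta ^+ 2))//.
      by rewrite ler_wpM2l ?(ltW lambda0)// lerXn2r ?nnegrE ?Kb ?(ltW beta_gt0).
    rewrite (le_trans (ler_wpM2r (sqr_ge0 beta) lambda_le))//.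
    rewrite le_eqVlt; apply/orP; left; apply/eqP; field.
    by rewrite gt_eqF.
have mreg : measurable_fun setT
    (fun t : N.-tuple (borel (data_space X0 Y0)) =>
      regularized_risk H F c t lambda).
  exact: measurable_regularized_risk.
have mev : measurable [set t : N.-tuple (borel (data_space X0 Y0)) |
    (delta%:E <= `|regularized_risk H F c t lambda - optimal_risk F c P|)%E].
  have mdist : measurable_fun setT
      (fun t : N.-tuple (borel (data_space X0 Y0)) =>
        `|regularized_risk H F c t lambda - optimal_risk F c P|)%E.
    apply: measurableT_comp; first exact: abse_measurable.
    by apply: emeasurable_funB.
  have := mdist measurableT `[delta%:E, +oo[%classic (emeasurable_itv _).
  rewrite setTI; congr measurable.
  by apply/seteqP; split => t /=; rewrite in_itv/= andbT.
apply: (markov_bound mev mD D0 _ _ iD); first by rewrite divr_gt0.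
move=> t /= /le_trans /(_ (dist t)); rewrite lee_fin; lra.
Qed.
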